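(* Let $n$, $k$ and $r$ be positive integers with $n \geq (k+1)r$, and let $\mathcal{A}$ be an intersecting subfamily of $[n]^{(r)}_k$, the family of $k$-separated $r$-element subsets of $[n]$. Then \[|\mathcal{A}| \leq \binom{n - kr - 1}{r - 1},\] and the upper bound is attained (equality holds) if, for some $x \in [n]$, $\mathcal{A} = \{A \in [n]^{(r)}_k \colon x \in A\}$.
   Context: $[n]$ denotes the set $\{1, \dots, n\}$. A family $\mathcal{A}$ of subsets of $[n]$ is intersecting if $A \cap B \neq \emptyset$ for every $A, B \in \mathcal{A}$. A subset $A = \{a_1, \dots, a_r\}$ of $[n]$ (with $r$ elements, listed in increasing order $a_1 < \dots < a_r$) is $k$-separated if $a_{i+1} > a_i + k$ for each $i \in [r]$, where $a_{r+1} = a_1 + n$. Equivalently, when the elements of $[n]$ are placed in order on a circle, between any two elements of $A$ there are at least $k$ elements of $[n]$ that are not in $A$. The family of all $k$-separated $r$-element subsets of $[n]$ is denoted by $[n]^{(r)}_k$. *)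

(* Defs.v *)
From mathcomp Require Import all_boot.

Set Implicit Arguments.
Unset Strict Implicit.
Unset Printing Implicit Defensive.

(* [n] is represented by 'I_n, i.e. by {0, ..., n-1} instead of {1, ..., n};  *)
(* the separation condition is invariant under this translation.              *)

(* [:: a_1; ...; a_r] with a_1 < ... < a_r, see elems_sorted. *)
Definition elems (n : nat) (A : {set 'I_n}) : seq nat :=
  [seq val i | i <- enum A].

Lemma elems_sorted (n : nat) (A : {set 'I_n}) : sorted ltn (elems A).
Proof.
rewrite /elems /enum_mem -enumT sorted_map.
apply: sorted_filter => [y x z|]; first exact: ltn_trans.
by have := iota_ltn_sorted 0 n; rewrite -val_enum_ord sorted_map enumT.
Qed.

(* The appended entry is a_{r+1} = a_1 + n. *)
Definition separated (n k : nat) (A : {set 'I_n}) : bool :=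
  let a := elems A in
  sorted (fun x y => x + k < y) (rcons a (head 0 a + n)).

Definition separated_sets (n k r : nat) : {set {set 'I_n}} :=
  [set A : {set 'I_n} | (#|A| == r) && separated k A].

Definition intersecting (n : nat) (F : {set {set 'I_n}}) : Prop :=
  forall A B, A \in F -> B \in F -> A :&: B != set0.

(* Main.v *)
(* Upper bound, by induction on n. Contract the edge {0, 1} of the n-cycle. Call a
   member of F critical if the contraction spoils its separation, or if it
   contains 0 and replacing 0 by 1 gives another member of F. The contraction is
   injective on the noncritical members and yields an intersecting family of
   r-sets in the (n-1)-cycle. A critical set meets the arc {0, ..., k} in exactly
   one point; deleting this point together with the arc is injective on the
   critical members and yields (r-1)-sets in the (n-k-1)-cycle, and these still
   pairwise intersect. Pascal's rule adds up the two bounds.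
   Equality: a star is intersecting, so only the lower bound is needed; rotate
   the centre to 0 and delete the arc {0, ..., k}, so that Pascal's rule applies to
   separated sets on a line. *)

Require Import Defs.
From mathcomp Require Import all_boot zify.

Set Implicit Arguments.
Unset Strict Implicit.
Unset Printing Implicit Defensive.

(* The ambient size [N] stays fixed while the length [n <= N] of the cycle shrinks
   in the inductions. *)
Definition spread (N n k : nat) (A : {set 'I_N}) : Prop :=
  (forall a, a \in elems A -> a < n) /\
  (forall a b, a \in elems A -> b \in elems A -> a < b ->
     a + k < b /\ b + k < a + n).

(** * Subsets of ['I_N] seen through their natural-number elements *)

Definition nat_set (N : nat) (P : pred nat) : {set 'I_N} := [set i : 'I_N | P i].

Lemma elemsP (N : nat) (A : {set 'I_N}) (m : nat) :
  reflect (exists2 i, i \in A & m = val i) (m \in elems A).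
Proof.
apply: (iffP mapP) => -[i iA ->]; exists i => //; first by rewrite -mem_enum.
by rewrite mem_enum.
Qed.

Lemma mem_elems (N : nat) (A : {set 'I_N}) (i : 'I_N) :
  (val i \in elems A) = (i \in A).
Proof. by rewrite (mem_map val_inj) mem_enum. Qed.

Lemma elems_uniq (N : nat) (A : {set 'I_N}) : uniq (elems A).
Proof. by rewrite (map_inj_uniq val_inj) enum_uniq. Qed.

Lemma size_elems (N : nat) (A : {set 'I_N}) : size (elems A) = #|A|.
Proof. by rewrite size_map cardE. Qed.

Lemma elems_ltn (N : nat) (A : {set 'I_N}) (m : nat) : m \in elems A -> m < N.
Proof. by case/elemsP => i _ ->; apply: ltn_ord. Qed.

Lemma elems_nat_set (N : nat) (P : pred nat) (m : nat) :
  (m \in elems (nat_set N P)) = (m < N) && P m.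
Proof.
apply/elemsP/andP => [[i]|[mN Pm]]; last first.
  by exists (Ordinal mN) => //; rewrite inE.
by rewrite inE => Pi ->; split; first exact: ltn_ord.
Qed.

Lemma elems_inj (N : nat) (A B : {set 'I_N}) : elems A =i elems B -> A = B.
Proof. by move=> eqAB; apply/setP => i; rewrite -!mem_elems. Qed.

Lemma card_elems (N : nat) (A : {set 'I_N}) (s : seq nat) :
  uniq s -> elems A =i s -> #|A| = size s.
Proof.
by move=> us eqs; rewrite -size_elems; apply: perm_size; apply: uniq_perm; rewrite ?elems_uniq.
Qed.

Lemma setI_elemsP (N : nat) (A B : {set 'I_N}) :
  reflect (exists2 m, m \in elems A & m \in elems B) (A :&: B != set0).
Proof.
apply: (iffP (set0Pn _)) => [[i /setIP[iA iB]]|[m /elemsP[i iA ->]]].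
  by exists (val i); rewrite mem_elems.
by rewrite mem_elems => iB; exists i; apply/setIP.
Qed.

(** * Contraction and deletion on the cycle *)

Definition contract (N : nat) (A : {set 'I_N}) : {set 'I_N} :=
  nat_set N (fun m => (m.+1 \in elems A) || (m == 0) && (0 \in elems A)).

(** Applied only to sets containing 0, where it replaces 0 by 1. *)
Definition swap01 (N : nat) (A : {set 'I_N}) : {set 'I_N} :=
  nat_set N (fun m => (m == 1) || (m != 0) && (m \in elems A)).

Definition drop_shift (N c : nat) (A : {set 'I_N}) : {set 'I_N} :=
  nat_set N (fun m => m + c \in elems A).

Lemma elems_contract (N : nat) (A : {set 'I_N}) (m : nat) :
  reflect (exists2 a, a \in elems A & m = a.-1) (m \in elems (contract A)).
Proof.
rewrite elems_nat_set; apply: (iffP idP) => [/andP[_ /orP[mA|/andP[/eqP-> A0]]]|].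
- by exists m.+1.
- by exists 0.
case=> -[|a] aA -> /=; first by rewrite aA orbT (elems_ltn aA).
by rewrite aA andbT (ltn_trans _ (elems_ltn aA)).
Qed.

Lemma elems_contractS (N : nat) (A : {set 'I_N}) (m : nat) :
  (m.+1 \in elems (contract A)) = (m.+2 \in elems A).
Proof.
apply/elems_contract/idP => [[a aA am]|mA]; last by exists m.+2.
by have -> : m.+2 = a by lia.
Qed.

Lemma elems_drop_shift (N c : nat) (A : {set 'I_N}) (m : nat) :
  (m \in elems (drop_shift c A)) = (m + c \in elems A).
Proof.
rewrite elems_nat_set andb_idl // => /elems_ltn.
exact/leq_ltn_trans/leq_addr.
Qed.

(* [contract] spoils the separation iff two elements at cyclic distance k+1 span
   the edge {0, 1}: either 0 and k+1, or p and p+n-k-1 with 0 < p <= k. *)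
Definition critical (N n k : nat) (F : {set {set 'I_N}}) (A : {set 'I_N}) :=
  has (fun p => (p <= k) &&
    if p == 0 then (k.+1 \in elems A) || (swap01 A \in F)
    else p + n - k.+1 \in elems A) (elems A).

(** * Contracting the noncritical sets *)

Lemma spread_card2 (N n k : nat) (A : {set 'I_N}) :
  spread n k A -> 1 < #|A| -> k.*2 + 2 <= n.
Proof.
move=> [_ sA] /card_gt1P[a [b [aA bA]]]; rewrite neq_ltn.
rewrite -!mem_elems in aA bA.
(* Two points leave two gaps on the cycle, each of at least [k] points. *)
by case/orP => lt; [have := sA _ _ aA bA lt|have := sA _ _ bA aA lt]; lia.
Qed.

(** For [a < b] only the arc through the edge {0, 1} gets shorter, by one: the arc from [a] to [b]
    if [a = 0], the wrap-around arc otherwise. It becomes too short only if its length was exactly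
    [k.+1], which makes the set critical. *)
Lemma contract_spread (N n k : nat) (F : {set {set 'I_N}}) (A : {set 'I_N}) :
  k.*2 + 2 <= n -> spread n k A -> ~~ critical n k F A ->
  spread n.-1 k (contract A).
Proof.
move=> n_ge [ltA sA] /hasPn ncA; split.
  by move=> _ /elems_contract[a /ltA ? ->]; lia.
move=> _ _ /elems_contract[a aA ->] /elems_contract[b bA ->] ltab.
have {ltab} ltab : a < b by lia.
have [h1 h2] := sA _ _ aA bA ltab.
have /= := ncA _ aA; have := ltA _ aA; have := ltA _ bA.
case: eqP => [a0 | a0].
  have [bE|] := eqVneq b k.+1; last by lia.
  by rewrite -bE bA a0.
(* In the tight case [b < n] forces [a <= k], so [a] witnesses criticality. *)
have [bE|] := eqVneq b (a + n - k.+1); last by lia.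
by rewrite -bE bA; lia.
Qed.

(** Only 0 and 1 get merged, and for [0 < k] a spread set cannot contain both. *)
Lemma card_contract (N n k : nat) (A : {set 'I_N}) :
  0 < k -> spread n k A -> #|contract A| = #|A|.
Proof.
move=> k0 [_ sA]; rewrite (@card_elems _ _ [seq a.-1 | a <- elems A]).
- by rewrite size_map size_elems.
- rewrite map_inj_in_uniq ?elems_uniq // => a b aA bA eqab.
  have := sA _ _ aA bA; have := sA _ _ bA aA.
  by case: (ltngtP a b) => // ? h1 h2; [have := h2 isT|have := h1 isT]; lia.
by move=> m; apply/elems_contract/mapP.
Qed.

(** Contraction forgets only which of 0 and 1 was present. If [C] has 0 and [D] has 1 instead, then
    [D] is [swap01 C], and its membership in [F] makes [C] critical. *)
Lemma contract_inj (N n k : nat) (F : {set {set 'I_N}}) (A B : {set 'I_N}) :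
  0 < k -> spread n k A -> spread n k B -> A \in F -> B \in F ->
  ~~ critical n k F A -> ~~ critical n k F B -> contract A = contract B -> A = B.
Proof.
move=> k0.
have main C D : spread n k C -> spread n k D -> D \in F -> ~~ critical n k F C ->
    contract C = contract D -> 0 \in elems C -> 0 \in elems D.
  move=> [_ sC] [_ sD] DF /hasPn ncC eqCD C0.
  have [d dD d0] : exists2 d, d \in elems D & 0 = d.-1.
    by apply/elems_contract; rewrite -eqCD; apply/elems_contract; exists 0.
  have [<- //|dn0] := eqVneq d 0.
  have {dn0 d0} d1 : d = 1 by lia.
  rewrite d1 in dD; have /= := ncC _ C0; rewrite negb_or => /andP[_ /negP[]].
  suff -> : swap01 C = D by [].
  apply: elems_inj => m; rewrite elems_nat_set.
  case: m => [|[|m]] /=.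
  + by rewrite andbF; apply/esym/negP => D0; have := sD _ _ D0 dD; lia.
  + by rewrite dD andbT (elems_ltn dD).
  by rewrite andb_idl; [rewrite -!elems_contractS eqCD|exact: elems_ltn].
move=> sA sB AF BF ncA ncB eqAB.
have eq0 : (0 \in elems A) = (0 \in elems B).
  by apply/idP/idP; [apply: main|apply: main].
apply: elems_inj => -[//|[|m]]; last by rewrite -!elems_contractS eqAB.
have mem1 C : spread n k C ->
    (1 \in elems C) = (0 \in elems (contract C)) && (0 \notin elems C).
  move=> [_ sC]; apply/idP/andP => [C1|[/elems_contract[c cC c0] nC0]].
    split; first by apply/elems_contract; exists 1.
    by apply/negP => C0; have := sC _ _ C0 C1; lia.
  have : c != 0 by apply: contraNneq nC0 => <-.
  by move=> ?; have <- : c = 1 by lia.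
by rewrite !mem1 // eqAB eq0.
Qed.

Lemma contract_intersecting (N : nat) (A B : {set 'I_N}) :
  A :&: B != set0 -> contract A :&: contract B != set0.
Proof.
case/setI_elemsP => m mA mB; apply/setI_elemsP.
by exists m.-1; apply/elems_contract; exists m.
Qed.

(** * Deleting the arc {0, ..., k} from the critical sets *)

Lemma criticalP (N n k : nat) (F : {set {set 'I_N}}) (A : {set 'I_N}) :
  reflect (exists p, [/\ p \in elems A, p <= k &
     [\/ [/\ p = 0 & k.+1 \in elems A], [/\ p = 0 & swap01 A \in F] |
         [/\ 0 < p & p + n - k.+1 \in elems A]]])
    (critical n k F A).
Proof.
apply: (iffP hasP) => [[p pA /andP[pk hp]]|[p [pA pk hp]]].
  exists p; split=> //; move: hp; case: eqP => [p0 /orP[]|/eqP p0] ?.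
  - by constructor 1.
  - by constructor 2.
  - by constructor 3; rewrite lt0n.
exists p => //; rewrite pk /=.
by case: hp => -[]; case: eqP => [-> | _] //= _ ->; rewrite ?orbT.
Qed.

(** Two points of the arc {0, ..., k} would be too close, so [p] is the only one, and [A] is
    recovered from [p] and the rest. *)
Lemma elems_cat_drop_shift (N n k : nat) (A : {set 'I_N}) (p m : nat) :
  spread n k A -> p \in elems A -> p <= k ->
  (m \in elems A) = (m == p) || (k < m) && (m - k.+1 \in elems (drop_shift k.+1 A)).
Proof.
move=> [_ sA] pA pk; rewrite elems_drop_shift; case: (ltnP k m) => km /=.
  by rewrite subnK // orb_idl // => /eqP->.
rewrite orbF; apply/idP/eqP => [mA|-> //].
by case: (ltngtP m p) => // lt; [have := sA _ _ mA pA lt|have := sA _ _ pA mA lt]; lia.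
Qed.

Lemma card_drop_shift (N n k : nat) (A : {set 'I_N}) (p : nat) :
  spread n k A -> p \in elems A -> p <= k -> #|drop_shift k.+1 A|.+1 = #|A|.
Proof.
move=> sA pA pk.
rewrite (@card_elems _ A (p :: [seq m + k.+1 | m <- elems (drop_shift k.+1 A)])).
- by rewrite /= size_map size_elems.
- rewrite /= map_inj_uniq ?elems_uniq ?andbT; last exact: addIn.
  by apply/mapP => -[x _]; lia.
move=> m; rewrite (elems_cat_drop_shift m sA pA pk) inE; congr (_ || _).
apply/andP/mapP => [[km mA]|[x xA ->]]; first by exists (m - k.+1); rewrite ?subnK.
by rewrite addnK; split=> //; lia.
Qed.

(** Only the wrap-around arc changes. In [A] it passes through [p], with at least [k.+1] steps on
    either side, so at least [k.+1] steps survive the deletion. *)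
Lemma drop_shift_spread (N n k : nat) (F : {set {set 'I_N}}) (A : {set 'I_N}) :
  k.*2 + 2 <= n -> (forall B, B \in F -> spread n k B) -> A \in F ->
  critical n k F A -> spread (n - k.+1) k (drop_shift k.+1 A).
Proof.
move=> n_ge sF AF /criticalP[p [pA pk hp]]; have [ltA sA] := sF _ AF; split.
  by move=> a; rewrite elems_drop_shift => /ltA; lia.
move=> a b; rewrite !elems_drop_shift => aA bA ltab.
have := sA _ _ aA bA; have := sA _ _ pA aA; have := sA _ _ pA bA.
have := ltA _ aA; have := ltA _ bA.
case: hp => -[p0 hA].
- by have := sA _ _ hA bA; have := sA _ _ hA aA; lia.
- have [_ sB] := sF _ hA.
  have inB x : x \in elems A -> 0 < x -> x \in elems (swap01 A).
    by move=> xA x0; rewrite elems_nat_set (elems_ltn xA) xA -lt0n x0 orbT.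
  have B1 : 1 \in elems (swap01 A).
    by rewrite elems_nat_set andbT; have := elems_ltn bA; lia.
  have := sB _ _ B1 (inB _ aA _); have := sB _ _ B1 (inB _ bA _); lia.
- have := sA _ _ aA hA; have := sA _ _ hA aA.
  have := sA _ _ bA hA; have := sA _ _ hA bA.
  lia.
Qed.

(** The sets agree beyond [k], so it remains to recover the point in the arc. If that point is
    positive, say [q], both sets contain [q + n - k.+1]; this is too close to 0, and also to
    [p + n - k.+1] for any other positive [p <= k]. *)
Lemma drop_shift_inj (N n k : nat) (F : {set {set 'I_N}}) (A B : {set 'I_N}) :
  k.*2 + 2 <= n -> (forall B, B \in F -> spread n k B) -> A \in F -> B \in F ->
  critical n k F A -> critical n k F B ->
  drop_shift k.+1 A = drop_shift k.+1 B -> A = B.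
Proof.
move=> n_ge sF AF BF /criticalP[p [pA pk hp]] /criticalP[q [qB qk hq]] eqAB.
have sA := sF _ AF; have sB := sF _ BF.
have memAB m : k < m -> (m \in elems A) = (m \in elems B).
  move=> km; rewrite (elems_cat_drop_shift m sA pA pk).
  rewrite (elems_cat_drop_shift m sB qB qk) eqAB.
  by have [-> ->] : (m == p) = false /\ (m == q) = false by lia.
suff pq : p = q.
  apply: elems_inj => m; rewrite (elems_cat_drop_shift m sA pA pk).
  by rewrite (elems_cat_drop_shift m sB qB qk) eqAB pq.
case: hp hq => -[hp hA] [] [hq hB]; try lia.
- by rewrite -memAB in hB; [have := sA.2 _ _ pA hB|]; lia.
- by rewrite -memAB in hB; [have := sA.2 _ _ pA hB|]; lia.
- by rewrite memAB in hA; [have := sB.2 _ _ qB hA|]; lia.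
- by rewrite memAB in hA; [have := sB.2 _ _ qB hA|]; lia.
rewrite -memAB in hB; last by lia.
by case: (ltngtP p q) => // lt; [have := sA.2 _ _ hA hB|have := sA.2 _ _ hB hA]; lia.
Qed.

Lemma drop_shift_intersecting (N n k : nat) (F : {set {set 'I_N}}) (A B : {set 'I_N}) :
  0 < k -> k.*2 + 2 <= n -> (forall B, B \in F -> spread n k B) ->
  intersecting F ->
  A \in F -> B \in F -> critical n k F A -> critical n k F B ->
  drop_shift k.+1 A :&: drop_shift k.+1 B != set0.
Proof.
move=> k0 n_ge sF iF AF BF /criticalP[p [pA pk hp]] /criticalP[q [qB qk hq]].
have sA := sF _ AF; have sB := sF _ BF.
have lowE (C : {set 'I_N}) c m : spread n k C -> c \in elems C -> c <= k -> m \in elems C ->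
    m <= k -> m = c.
  move=> sC cC ck mC mk; rewrite (elems_cat_drop_shift m sC cC ck) in mC.
  by case/orP: mC => [/eqP//|]; lia.
suff [m km [mA mB]] : exists2 m, k < m & m \in elems A /\ m \in elems B.
  by apply/setI_elemsP; exists (m - k.+1); rewrite elems_drop_shift subnK.
(* If the arc points differ, any common point lies beyond the arc. *)
have [eqpq|neqpq] := eqVneq p q; last first.
  have /setI_elemsP[m mA mB] := iF _ _ AF BF.
  exists m => //; rewrite ltnNge; apply: contraNN neqpq => mk.
  by rewrite -(lowE _ _ _ sA pA pk mA mk) (lowE _ _ _ sB qB qk mB mk).
(* A common point of [swap01 C] and [D] is not 0, which [swap01] removes, nor 1, which is adjacent
   to 0 in [D]; hence it is a point of [C] beyond the arc. *)
subst q; have swapI C D : 0 \in elems D -> D \in F -> swap01 C \in F ->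
    exists2 m, k < m & m \in elems C /\ m \in elems D.
  move=> D0 DF CF; have /setI_elemsP[m] := iF _ _ CF DF.
  rewrite elems_nat_set => mC mD.
  have m0 : m <= k -> m = 0 by apply: lowE mD => //; apply: sF.
  case/andP: mC => _ /orP[/eqP m1|/andP[mn0 mC]]; last first.
    by exists m => //; rewrite ltnNge; apply: contraNN mn0 => /m0->.
  have [_ sD] := sF _ DF.
  by subst m; have := sD _ _ D0 mD; lia.
(* For [p = 0] either both sets contain [k.+1] or a swapped set lies in [F]; for [p > 0] they share
   [p + n - k.+1]. *)
case: hp hq => -[hp hA] [] [hq hB]; try lia; subst; try by exists (k.+1).
- by have [m km [mA mB]] := swapI _ _ pA AF hB; exists m.
- exact: swapI.
- exact: swapI.
by exists (p + n - k.+1) => //; lia.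
Qed.

(** * The upper bound, by induction on the length of the cycle *)

Theorem intersecting_spread_bound (N n k r : nat) (F : {set {set 'I_N}}) :
  0 < k -> 0 < r -> (forall A, A \in F -> spread n k A /\ #|A| = r) ->
  intersecting F -> #|F| <= 'C(n - k * r - 1, r - 1).
Proof.
move=> k0; elim/ltn_ind: n r F => n IH r F r0 hF iF.
have [r1|r1] := leqP r 1.
  have {r1 r0} r1 : r = 1 by lia.
  rewrite r1 subnn bin0; apply/card_le1_eqP => A B AF BF.
  have [_ /eqP] := hF _ AF; have [_ /eqP] := hF _ BF.
  rewrite r1 => /cards1P[b eB] /cards1P[a eA].
  have /set0Pn[c] := iF _ _ AF BF.
  by rewrite eA eB !inE => /andP[/eqP<- /eqP<-].
have [->|/set0Pn[A0 A0F]] := eqVneq F set0; first by rewrite cards0.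
have n_ge : k.*2 + 2 <= n.
  by have [sA cA] := hF _ A0F; apply: spread_card2 sA _; rewrite cA.
have sF A : A \in F -> spread n k A by case/hF.
set H := [set A in F | critical n k F A].
have HP A : A \in H -> A \in F /\ critical n k F A by rewrite inE => /andP.
have cP A : A \in F :\: H -> A \in F /\ ~~ critical n k F A.
  by rewrite !inE => /andP[+ AF]; rewrite AF.
rewrite -(cardsID H F); have /setIidPr -> : H \subset F by apply/subsetP => A /HP[].
(* Both reductions, to [(n - k.+1, r.-1)] and to [(n.-1, r)], lower [n - k * r - 1] by one, as
   Pascal's rule requires. *)
have cardH : #|H| <= 'C(n - k * r - 2, r - 2).
  rewrite -(card_in_imset (f := drop_shift k.+1)); last first.
    by move=> A B /HP[AF cA] /HP[BF cB]; apply: drop_shift_inj cA cB.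
  have -> : n - k * r - 2 = n - k.+1 - k * r.-1 - 1 by nia.
  have -> : r - 2 = r.-1 - 1 by lia.
  apply: IH; try lia.
    move=> _ /imsetP[A /HP[AF cA] ->]; split; first exact: drop_shift_spread cA.
    have [sA <-] := hF _ AF; have /criticalP[p [pA pk _]] := cA.
    by rewrite -(card_drop_shift sA pA pk).
  move=> _ _ /imsetP[A /HP[AF cA] ->] /imsetP[B /HP[BF cB] ->].
  exact: drop_shift_intersecting cA cB.
have cardD : #|F :\: H| <= 'C(n - k * r - 2, r - 1).
  rewrite -(card_in_imset (f := @contract N)); last first.
    move=> A B /cP[AF cA] /cP[BF cB].
    by apply: contract_inj cA cB => //; apply: sF.
  have -> : n - k * r - 2 = n.-1 - k * r - 1 by lia.
  apply: IH; try lia.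
    move=> _ /imsetP[A /cP[AF cA] ->]; have [sA <-] := hF _ AF.
    by split; [apply: contract_spread cA|apply: card_contract sA].
  move=> _ _ /imsetP[A /cP[AF _] ->] /imsetP[B /cP[BF _] ->].
  exact/contract_intersecting/iF.
apply: leq_trans (leq_add cardH cardD) _.
case: r r0 r1 {hF} cardH cardD => [|[|r]] // _ _ _ _; rewrite !subSS !subn0.
have [lt|ge] := ltnP (k * r.+2 + 1) n.
  have -> : n - k * r.+2 - 1 = (n - k * r.+2 - 2).+1 by lia.
  by rewrite binS addnC.
(* Truncated subtraction makes all upper indices 0. The lower index [r] is positive, since [r = 0]
   would make [n_ge] contradict [ge]. *)
by rewrite !bin_small //; nia.
Qed.

(** * Separated sets on a line *)

Definition shift_up (N d : nat) (A : {set 'I_N}) : {set 'I_N} :=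
  nat_set N (fun m => (d <= m) && (m - d \in elems A)).

(** For [d = k.+1] this undoes the deletion of the arc {0, ..., k} from a spread set containing
    0. *)
Definition cons0_shift (N d : nat) (A : {set 'I_N}) : {set 'I_N} :=
  nat_set N (fun m => (m == 0) || (d <= m) && (m - d \in elems A)).

Lemma elems_shift_up (N d : nat) (A : {set 'I_N}) :
  (forall a, a \in elems A -> a + d < N) ->
  elems (shift_up d A) =i [seq a + d | a <- elems A].
Proof.
move=> ltA m; rewrite elems_nat_set; apply/and3P/mapP => [[mN dm mA]|[a aA ->]].
  by exists (m - d); rewrite ?subnK.
by rewrite ltA // leq_addl addnK.
Qed.

Lemma elems_cons0_shift (N d : nat) (A : {set 'I_N}) :
  0 < N -> (forall a, a \in elems A -> a + d < N) ->
  elems (cons0_shift d A) =i 0 :: [seq a + d | a <- elems A].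
Proof.
move=> N0 ltA m; rewrite inE -elems_shift_up // !elems_nat_set.
by case: eqP => [->|//]; rewrite N0.
Qed.

Lemma card_shift_up (N d : nat) (A : {set 'I_N}) :
  (forall a, a \in elems A -> a + d < N) -> #|shift_up d A| = #|A|.
Proof.
move=> ltA; rewrite (card_elems _ (elems_shift_up ltA)).
  by rewrite size_map size_elems.
by rewrite map_inj_uniq ?elems_uniq //; apply: addIn.
Qed.

Lemma card_cons0_shift (N d : nat) (A : {set 'I_N}) :
  0 < d -> 0 < N -> (forall a, a \in elems A -> a + d < N) ->
  #|cons0_shift d A| = #|A|.+1.
Proof.
move=> d0 N0 ltA; rewrite (card_elems _ (elems_cons0_shift N0 ltA)).
  by rewrite /= size_map size_elems.
rewrite /= map_inj_uniq ?elems_uniq ?andbT; last exact: addIn.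
by apply/mapP => -[a _]; lia.
Qed.

Lemma shift_up_inj (N d : nat) (A B : {set 'I_N}) :
  (forall a, a \in elems A -> a + d < N) -> (forall b, b \in elems B -> b + d < N) ->
  shift_up d A = shift_up d B -> A = B.
Proof.
have mem_shift (C : {set 'I_N}) m : (forall c, c \in elems C -> c + d < N) ->
    (m \in elems C) = (m + d \in elems (shift_up d C)).
  move=> ltC; rewrite elems_nat_set leq_addl addnK /=.
  by apply/idP/andP => [mC|[]//]; rewrite ltC.
move=> ltA ltB eqAB; apply: elems_inj => m.
by rewrite (mem_shift A) // (mem_shift B) // eqAB.
Qed.

Lemma cons0_shift_inj (N d : nat) (A B : {set 'I_N}) :
  0 < d -> 0 < N ->
  (forall a, a \in elems A -> a + d < N) -> (forall b, b \in elems B -> b + d < N) ->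
  cons0_shift d A = cons0_shift d B -> A = B.
Proof.
move=> d0 N0 ltA ltB eqAB; apply: (shift_up_inj ltA ltB); apply: elems_inj => m.
have : (m \in elems (cons0_shift d A)) = (m \in elems (cons0_shift d B)) by rewrite eqAB.
by rewrite !elems_nat_set; case: (m =P 0) => [->|//]; rewrite leqn0 (gtn_eqF d0) !andbF.
Qed.

(* For [M = n - 2k - 1] these are the sets [drop_shift k.+1 A] with [A] spread and
   [0 \in A]. *)
Lemma linear_separated_family (N M k s : nat) :
  0 < N -> M <= N ->
  exists S : {set {set 'I_N}}, #|S| = 'C(M - k * s.-1, s) /\
    forall A, A \in S -> [/\ #|A| = s, forall a, a \in elems A -> a < M &
      forall a b, a \in elems A -> b \in elems A -> a < b -> a + k < b].
Proof.
move=> N0; elim/ltn_ind: M s => M IH [|s] MN.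
  exists [set set0]; rewrite cards1 bin0; split=> // A /set1P->.
  have e0 a : a \in elems (set0 : {set 'I_N}) = false.
    by apply/elemsP => -[i]; rewrite inE.
  by split=> [|a|a b]; rewrite ?cards0 ?e0.
have [M_le|M_gt] := leqP M (k * s).
  exists set0; rewrite cards0 bin_small; last by rewrite /=; lia.
  by split=> // A; rewrite inE.
(* Sets avoiding 0 come from a line of [M.-1] points. Sets containing 0 come from [s] further points
   on the line left after removing {0, ..., k}. *)
have [||S1 [cS1 hS1]] := IH M.-1 _ s.+1; try lia.
have [||S2 [cS2 hS2]] := IH (M - k.+1) _ s; try lia.
have lt1 A : A \in S1 -> forall a, a \in elems A -> a + 1 < N.
  by case/hS1 => _ lt _ a /lt; lia.
have lt2 A : A \in S2 -> forall a, a \in elems A -> a + k.+1 < N.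
  by case/hS2 => _ lt _ a /lt; lia.
exists ([set shift_up 1 A | A in S1] :|: [set cons0_shift k.+1 A | A in S2]); split.
  rewrite cardsU (_ : _ :&: _ = set0) ?cards0 ?subn0; last first.
    apply/setP => C; rewrite !inE; apply/andP => -[/imsetP[A A1 ->] /imsetP[B B2]].
    move/setP/(_ (Ordinal N0)); rewrite -!mem_elems.
    by rewrite !elems_nat_set /= N0.
  rewrite !card_in_imset; first last.
  - by move=> A B /lt1 ltA /lt1 ltB; apply: shift_up_inj.
  - by move=> A B /lt2 ltA /lt2 ltB; apply: cons0_shift_inj.
  rewrite cS1 cS2 /=.
  have -> : M - k * s = (M.-1 - k * s).+1 by lia.
  (* For [s = 0] the truncated [s.-1] can make the upper indices differ, but both binomials are then
     1. *)
  rewrite binS; congr (_ + _); case: s {IH M_gt cS1 hS1 cS2 hS2} => [|s] /=.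
    by rewrite !bin0.
  by congr 'C(_, _); lia.
move=> C /setUP[] /imsetP[A AS ->].
  have [cA ltA sA] := hS1 _ AS; have e := elems_shift_up (lt1 _ AS).
  split; first by rewrite card_shift_up //; apply: lt1.
    by move=> a; rewrite e => /mapP[c /ltA ? ->]; lia.
  move=> a b; rewrite !e => /mapP[c cA' ->] /mapP[d dA' ->].
  by have := sA _ _ cA' dA'; lia.
have [cA ltA sA] := hS2 _ AS; have e := elems_cons0_shift N0 (lt2 _ AS).
split; first by rewrite card_cons0_shift ?cA //; apply: lt2.
  by move=> a; rewrite e inE => /predU1P[->|/mapP[c /ltA ? ->]]; lia.
move=> a b; rewrite !e !inE.
move=> /predU1P[->|/mapP[c cA' ->]] /predU1P[->|/mapP[d dA' ->]]; try lia.
by have := sA _ _ cA' dA'; lia.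
Qed.

(** * The star centred at 0 *)

Lemma star0_family (n k r : nat) :
  0 < k -> 0 < r -> (k + 1) * r <= n ->
  exists S : {set {set 'I_n}}, #|S| = 'C(n - k * r - 1, r - 1) /\
    forall A, A \in S -> [/\ #|A| = r, spread n k A & 0 \in elems A].
Proof.
move=> k0 r0 n_ge; have n0 : 0 < n by nia.
(* Besides 0, the elements lie among the [n - k.*2 - 1] positions from [k.+1] to [n - k.+1]. *)
have [|S [cS hS]] := @linear_separated_family n (n - k.*2 - 1) k r.-1 n0.
  by lia.
have ltS A : A \in S -> forall a, a \in elems A -> a + k.+1 < n.
  by case/hS => _ lt _ a /lt; lia.
exists [set cons0_shift k.+1 A | A in S]; split.
  rewrite card_in_imset; last first.
    by move=> A B /ltS ltA /ltS ltB; apply: cons0_shift_inj.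
  rewrite cS; case: r {cS hS} r0 n_ge => [|[|r]] // _ n_ge; rewrite ?bin0 //=.
  by congr 'C(_, _); lia.
move=> _ /imsetP[A AS ->]; have [cA ltA sA] := hS _ AS.
have e := elems_cons0_shift n0 (ltS _ AS).
split; first by rewrite card_cons0_shift ?cA ?prednK //; apply: ltS.
  split=> [a|a b].
    by rewrite e inE => /predU1P[->|/mapP[c /ltA ? ->]]; lia.
  rewrite !e !inE.
  move=> /predU1P[->|/mapP[c cA' ->]] /predU1P[->|/mapP[d dA' ->]]; try lia.
    by have := ltA _ dA'; lia.
  by have := sA _ _ cA' dA'; have := ltA _ dA'; lia.
by rewrite e inE.
Qed.

(** * Rotations of the cycle *)

Definition rotate (n : nat) (n_gt0 : 0 < n) (x i : 'I_n) : 'I_n :=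
  Ordinal (ltn_pmod (i + x) n_gt0).

Lemma rotateE (n : nat) (n_gt0 : 0 < n) (x i : 'I_n) :
  rotate n_gt0 x i = (if i + x < n then i + x else i + x - n) :> nat.
Proof.
have := ltn_ord i; have := ltn_ord x; rewrite /rotate /=; case: (ltnP (i + x) n) => h hx hi.
  exact: modn_small.
by rewrite -[in LHS](subnK h) modnDr modn_small //; lia.
Qed.

Lemma rotate_inj (n : nat) (n_gt0 : 0 < n) (x : 'I_n) : injective (rotate n_gt0 x).
Proof.
move=> i j eqij; apply: val_inj => /=.
have := rotateE n_gt0 x i; rewrite eqij rotateE.
have := ltn_ord i; have := ltn_ord j; have := ltn_ord x.
by case: (ltnP (j + x) n); case: (ltnP (i + x) n); lia.
Qed.

Lemma rotate_spread (n k : nat) (n_gt0 : 0 < n) (x : 'I_n) (A : {set 'I_n}) :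
  spread n k A -> spread n k [set rotate n_gt0 x i | i in A].
Proof.
move=> [_ sA]; split=> [a /elems_ltn //|a b].
case/elemsP => _ /imsetP[i iA ->] -> /elemsP[_ /imsetP[j jA ->] ->].
rewrite -![val _]/(nat_of_ord _) !rotateE.
rewrite -!mem_elems -![val _]/(nat_of_ord _) in iA jA.
(* Rotation may reverse the order of the two points and so exchange the two inequalities. *)
have := sA _ _ iA jA; have := sA _ _ jA iA.
have := ltn_ord i; have := ltn_ord j; have := ltn_ord x.
by case: (ltnP (i + x) n); case: (ltnP (j + x) n); lia.
Qed.

(** * Separation in terms of [spread] *)

Lemma separated_pairwise (n k : nat) (A : {set 'I_n}) :
  separated k A = all (fun x => x + k < head 0 (elems A) + n) (elems A) &&
                  pairwise (fun x y => x + k < y) (elems A).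
Proof.
(* The relation [x + k < y] is transitive, so comparing neighbours amounts to comparing all
   pairs. *)
by rewrite /separated sorted_pairwise ?pairwise_rcons // => y x z; lia.
Qed.

Lemma separated_spread (n k r : nat) (A : {set 'I_n}) :
  0 < r -> k < n -> A \in separated_sets n k r <-> #|A| = r /\ spread n k A.
Proof.
move=> r0 kn; rewrite inE separated_pairwise -size_elems.
have ltA := @elems_ltn _ A; have := elems_sorted A; rewrite /spread.
set s := elems A in ltA *; rewrite sorted_pairwise; last exact: ltn_trans.
move=> sorted_s; split=> [/andP[/eqP cA /andP[/allP le_head /(pairwiseP 0) gaps]]|].
  split=> //; split=> // a b sa sb ltab.
  have head_le : head 0 s <= a.
    case: (s) sorted_s sa => //= h t /andP[/allP h_lt _].
    by rewrite inE => /predU1P[->|/h_lt/ltnW].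
  split; last by have := le_head _ sb; lia.
  have := gaps (index a s) (index b s); have := gaps (index b s) (index a s).
  rewrite !inE !index_mem !nth_index // => /(_ sb sa) gap_ba /(_ sa sb) gap_ab.
  case: (ltngtP (index a s) (index b s)) => [/gap_ab //|/gap_ba|eq_index]; first by lia.
  by move: ltab; rewrite -(nth_index 0 sa) eq_index nth_index // ltnn.
case=> cA [_ sA]; rewrite cA eqxx /=; apply/andP; split.
  apply/allP => x sx; have sh : head 0 s \in s by case: (s) sx => // h t _; apply: mem_head.
  (* When [x] is the head itself, the inequality is [k < n]. *)
  by have := sA _ _ sh sx; lia.
apply: (sub_in_pairwise _ (allss s) sorted_s) => a b sa sb ltab.
by have [] := sA _ _ sa sb ltab.
Qed.

(** * Bound and equality for [separated_sets] *)

Theorem theorem2 (n k r : nat) (F : {set {set 'I_n}})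
    (n_gt0 : 0 < n) (k_gt0 : 0 < k) (r_gt0 : 0 < r)
    (n_ge : (k + 1) * r <= n)
    (F_sep : F \subset separated_sets n k r)
    (F_int : intersecting F) :
  #|F| <= 'C(n - k * r - 1, r - 1) /\
  ((exists x : 'I_n, F = [set A in separated_sets n k r | x \in A]) ->
   #|F| = 'C(n - k * r - 1, r - 1)).
Proof.
have k_ltn : k < n by nia.
have sepP := separated_spread _ r_gt0 k_ltn.
have bound : #|F| <= 'C(n - k * r - 1, r - 1).
  apply: (intersecting_spread_bound k_gt0 r_gt0) => // A AF.
  by have /sepP[] := subsetP F_sep _ AF.
split=> // -[x eqF]; apply/eqP; rewrite eqn_leq bound /=.
have [S [<- hS]] := star0_family k_gt0 r_gt0 n_ge.
(* Rotation by [x] carries the sets of [S], all containing 0, injectively into the star [F] at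
   [x]. *)
rewrite -(card_imset S (imset_inj (@rotate_inj _ n_gt0 x))).
apply/subset_leq_card/subsetP => _ /imsetP[A AS ->]; have [cA sA A0] := hS _ AS.
rewrite eqF inE; apply/andP; split.
  apply/sepP; split; last exact: rotate_spread.
  by rewrite card_imset //; apply: rotate_inj.
move: A0; rewrite -[0]/(val (Ordinal n_gt0)) mem_elems => A0.
apply/imsetP; exists (Ordinal n_gt0) => //; apply: val_inj.
by rewrite [RHS]rotateE add0n ltn_ord.
Qed.
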